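(* In the non-preemptive sUETS problem, the online algorithm that assigns the single batch $J$ (all jobs) to one machine is $m$-competitive.
   Context: Non-preemptive sUETS: a finite set $J$ of $n$ jobs and $m$ identical machines, $n\ge m\ge 2$, all jobs available at time $0$. A known setup-time function $c:2^J\to\mathbb{R}_{\ge0}$ is monotone ($c(X)\le c(Y)$ for $X\subseteq Y$) and subadditive ($c(X)+c(Y)\ge c(X\cup Y)$ for disjoint $X,Y$). Each job $j$ has execution time $p_j\ge0$, unknown to an online algorithm until $j$ completes; $p(X)=\sum_{j\in X}p_j$. An algorithm repeatedly forms batches (sets of jobs not completed and not assigned elsewhere) and assigns each batch to a single idle machine, which processes batch $X$ without interruption in time $c(X)+p(X)$. The makespan is the completion time of all jobs. The optimal makespan is $\min_{(X_1,\dots,X_m)\text{ partition of }J}\max_{i}(c(X_i)+p(X_i))$. An algorithm is $\rho$-competitive if its makespan is at most $\rho$ times the optimal makespan on every instance. *)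

(* Defs.v *)
From mathcomp Require Import all_boot all_order all_algebra.
From mathcomp Require Import boolp classical_sets reals.

Set Implicit Arguments.
Unset Strict Implicit.
Unset Printing Implicit Defensive.

Import Order.TTheory GRing.Theory Num.Theory.
Local Open Scope ring_scope.

Definition subadditive (R : realType) (J : finType) (c : {set J} -> R) : Prop :=
  forall X Y : {set J}, [disjoint X & Y] -> c (X :|: Y) <= c X + c Y.

Record sUETS_instance (R : realType) (m : nat) (J : finType)
    (c : {set J} -> R) (p : J -> R) : Prop := SUETSInstance {
  machines_ge2 : (2 <= m)%N;
  jobs_ge_machines : (m <= #|J|)%N;
  setup_ge0 : forall X : {set J}, 0 <= c X;
  setup_monotone : forall X Y : {set J}, X \subset Y -> c X <= c Y;
  setup_subadditive : subadditive c;
  exec_ge0 : forall j : J, 0 <= p j }.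

Definition proc_time (R : realType) (J : finType) (c : {set J} -> R)
    (p : J -> R) (X : {set J}) : R :=
  c X + \sum_(j in X) p j.

(* Parts may be empty: a machine may stay unused. *)
Definition is_partition (m : nat) (J : finType) (X : 'I_m -> {set J}) : Prop :=
  (forall i k : 'I_m, i != k -> [disjoint X i & X k]) /\
  \bigcup_(i < m) X i = [set: J]%SET.

(* Processing times are nonnegative, so 0 is a neutral base for the maximum. *)
Definition partition_makespan (R : realType) (m : nat) (J : finType)
    (c : {set J} -> R) (p : J -> R) (X : 'I_m -> {set J}) : R :=
  \big[Num.max/0]_(i < m) proc_time c p (X i).

(* The infimum ranges over finitely many values, hence is a minimum as soon as
   there is a machine; see opt_makespan_min. *)
Definition opt_makespan (R : realType) (m : nat) (J : finType)
    (c : {set J} -> R) (p : J -> R) : R :=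
  inf [set v | exists2 X : 'I_m -> {set J},
                 is_partition X & v = partition_makespan c p X]%classic.

Lemma opt_makespan_min (R : realType) (m : nat) (J : finType)
    (c : {set J} -> R) (p : J -> R) : (0 < m)%N ->
  (exists2 X : 'I_m -> {set J},
     is_partition X & opt_makespan m c p = partition_makespan c p X) /\
  (forall X : 'I_m -> {set J},
     is_partition X -> opt_makespan m c p <= partition_makespan c p X).
Proof.
move=> m0; pose i0 := Ordinal m0.
pose P (X : {ffun 'I_m -> {set J}}) := `[< is_partition X >].
pose F (X : {ffun 'I_m -> {set J}}) := partition_makespan c p X.
pose X0 : {ffun 'I_m -> {set J}} :=
  [ffun i => if i == i0 then finset.setT else finset.set0].
have PX0 : P X0.
  apply/asboolP; split=> [i k|].
    rewrite !ffunE -setI_eq0.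
    case: (eqVneq i i0) => [->|_ _]; last by rewrite finset.set0I.
    by rewrite eq_sym => /negPf ->; rewrite finset.setI0.
  apply/setP => j; rewrite finset.in_setT; apply/bigcupP.
  by exists i0 => //; rewrite ffunE eqxx finset.in_setT.
have [Y /asboolP PY Ymin] := @Order.TotalTheory.arg_minP _ _ _ X0 P F PX0.
have Yle (X : 'I_m -> {set J}) : is_partition X ->
    partition_makespan c p Y <= partition_makespan c p X.
  move=> HX; have XE : finfun X = X :> ('I_m -> _) by apply/funext => i; rewrite ffunE.
  by rewrite -XE; apply: Ymin; apply/asboolP; rewrite XE.
suff -> : opt_makespan m c p = partition_makespan c p Y by split=> //; exists Y.
apply/eqP; rewrite eq_le; apply/andP; split.
  apply: ge_inf; last by exists Y.
  by exists (partition_makespan c p Y) => _ [X HX ->]; exact: Yle.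
apply: lb_le_inf; first by exists (partition_makespan c p Y), Y.
by move=> _ [X HX ->]; exact: Yle.
Qed.

(* Logs are lists of started batches, in order of their start. *)
Record batch (R : realType) (m : nat) (J : finType) := Batch {
  batch_jobs : {set J};
  batch_machine : 'I_m;
  batch_start : R }.

Section Execution.
Variables (R : realType) (m : nat) (J : finType).
Variables (c : {set J} -> R) (p : J -> R).

Definition completion (b : batch R m J) : R :=
  batch_start b + proc_time c p (batch_jobs b).

Definition assigned (h : seq (batch R m J)) : {set J} :=
  \bigcup_(b <- h) batch_jobs b.

Definition idle (t : R) (h : seq (batch R m J)) (i : 'I_m) : bool :=
  all (fun b => (batch_machine b == i) ==> (completion b <= t)) h.

(* The jobs of a batch complete when the batch does. *)
Definition revealed (t : R) (h : seq (batch R m J)) (j : J) : option R :=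
  if has (fun b => (j \in batch_jobs b) && (completion b <= t)) h
  then Some (p j) else None.

(* Wait u: do nothing until time u or the next batch completion,
   whichever comes first. *)
Inductive action :=
| Assign of {set J} & 'I_m
| Wait of R.

Definition wake_time (t u : R) (h : seq (batch R m J)) : R :=
  \big[Num.min/u]_(b <- h | t < completion b) completion b.

(* A policy decides from the current time, the log, and the execution times of
   the completed jobs (None for the others). *)
Definition policy := R -> seq (batch R m J) -> (J -> option R) -> action.

(* States (current time, log) met when executing A.  As batches are never
   interrupted, the jobs neither completed nor assigned elsewhere are exactly
   those outside the log.  An inadmissible action blocks the execution. *)
Inductive reachable (A : policy) : R -> seq (batch R m J) -> Prop :=
| reach_init : reachable A 0 [::]
| reach_assign t h X i :
    reachable A t h -> A t h (revealed t h) = Assign X i ->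
    X != finset.set0 -> [disjoint X & assigned h] -> idle t h i ->
    reachable A t (rcons h (Batch X i t))
| reach_wait t h u :
    reachable A t h -> A t h (revealed t h) = Wait u -> t < u ->
    reachable A (wake_time t u h) h.

(* Once every job has been started the log no longer changes, since batches
   are nonempty; so a policy has at most one full log. *)
Definition full_run (A : policy) (h : seq (batch R m J)) : Prop :=
  (exists t : R, reachable A t h) /\ assigned h = [set: J]%SET.

Definition makespan (h : seq (batch R m J)) : R :=
  \big[Num.max/0]_(b <- h) completion b.

End Execution.

Arguments Assign {R m J}.
Arguments Wait {R m J}.

(* The job set and the setup function are known in advance, the execution
   times are not. *)
Definition online_algorithm (R : realType) (m : nat) : Type :=
  forall J : finType, ({set J} -> R) -> policy R m J.

Definition competitive (R : realType) (m : nat) (rho : R)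
    (A : online_algorithm R m) : Prop :=
  forall (J : finType) (c : {set J} -> R) (p : J -> R),
    sUETS_instance m c p ->
    (exists h, full_run c p (A J c) h) /\
    (forall h, full_run c p (A J c) h ->
       makespan c p h <= rho * opt_makespan m c p).

(* Nothing is left to decide after the first step; the waiting is idle. *)
Definition single_batch (R : realType) (m : nat) (i : 'I_m) :
    online_algorithm R m :=
  fun J c t h _ => if h is [::] then Assign [set: J]%SET i else Wait (t + 1).

(* Main.v *)
Require Import Defs.
From mathcomp Require Import all_boot all_order all_algebra.
From mathcomp Require Import reals.

(** In an optimal partition every part takes at most the optimal makespan, and
    the processing time of a batch is subadditive like the setup time, so the
    batch of all jobs takes at most [m] times the optimal makespan. *)

Set Implicit Arguments.
Unset Strict Implicit.
Unset Printing Implicit Defensive.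

Import Order.TTheory GRing.Theory Num.Theory.
Local Open Scope ring_scope.

(* There must be at least one part, as [f set0] may be positive. *)
Lemma subadditive_bigcup (R : realType) (J : finType) (f : {set J} -> R)
    (n : nat) (X : 'I_n.+1 -> {set J}) :
  subadditive f -> (forall i k, i != k -> [disjoint X i & X k]) ->
  f (\bigcup_(i < n.+1) X i) <= \sum_(i < n.+1) f (X i).
Proof.
move=> fD; elim: n X => [|n IHn] X dX; first by rewrite !big_ord1.
rewrite big_ord_recl [leRHS]big_ord_recl; apply: le_trans (fD _ _ _) _.
  by apply: bigcup_disjoint => k _; apply: dX; apply: neq_lift.
rewrite lerD2l; apply: IHn => i k neq_ik; apply: dX.
by rewrite (inj_eq lift_inj).
Qed.

(** Execution times add up exactly over disjoint sets, so only the setup times enter the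
    inequality. *)
Lemma proc_time_subadditive (R : realType) (J : finType) (c : {set J} -> R)
    (p : J -> R) : subadditive c -> subadditive (proc_time c p).
Proof.
move=> cD X Y dXY; rewrite /proc_time (eq_bigl _ _ (fun j => in_setU j X Y)).
by rewrite bigU //= addrACA lerD2r; exact: cD.
Qed.

Lemma proc_time_le_partition (R : realType) (m : nat) (J : finType)
    (c : {set J} -> R) (p : J -> R) (X : 'I_m -> {set J}) :
  (0 < m)%N -> subadditive c -> is_partition X ->
  proc_time c p [set: J] <= m%:R * partition_makespan c p X.
Proof.
case: m X => // m X _ cD [dX <-].
apply: le_trans (subadditive_bigcup (proc_time_subadditive p cD) dX) _.
(* The bound becomes a constant sum over the machines, to be compared term by term. *)
rewrite mulr_natl -[X in _ *+ X]card_ord -sumr_const.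
apply: ler_sum => k _; exact: (le_bigmax 0 (fun k => proc_time c p (X k))).
Qed.

(** The policy never waits on an empty log and never assigns on a nonempty one. The invariant keeps
    [t = 0] for the empty log because it fixes the start of the batch. *)
Lemma single_batch_log (R : realType) (m : nat) (i : 'I_m) (J : finType)
    (c : {set J} -> R) (p : J -> R) (t : R) (h : seq (batch R m J)) :
  reachable c p (single_batch i c) t h ->
  h = [::] /\ t = 0 \/ h = [:: Batch [set: J] i 0].
Proof.
elim=> {t h} [|t h X k _ IH actE _ _ _|t h u _ IH actE _]; first by left.
- by case: IH actE => [[-> ->]|->] //= [<- <-]; right.
- by case: IH actE => [[-> _]|->] //=; right.
Qed.

Lemma single_batch_full_run (R : realType) (m : nat) (i : 'I_m) (J : finType)
    (c : {set J} -> R) (p : J -> R) :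
  (0 < #|J|)%N -> full_run c p (single_batch i c) [:: Batch [set: J] i 0].
Proof.
move=> J_gt0; split; last by rewrite /assigned big_seq1.
(* [J_gt0] serves to make the assigned batch nonempty. *)
exists 0; rewrite -[[:: _]]/(rcons [::] _); apply: reach_assign => //.
- exact: reach_init.
- by rewrite -card_gt0 cardsT.
- by rewrite /assigned big_nil -setI_eq0 setI0.
Qed.

Theorem theorem2 (R : realType) (m : nat) (i : 'I_m) :
  competitive (m%:R)%R (@single_batch R m i).
Proof.
move=> J c p [m_ge2 m_leJ _ _ cD _].
have m_gt0 : (0 < m)%N by apply: ltnW.
have J_gt0 : (0 < #|J|)%N by apply: leq_trans m_leJ.
split=> [|h [[t reach_h] full_h]].
  by exists [:: Batch [set: J] i 0]; apply: single_batch_full_run.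
case: (single_batch_log reach_h) full_h => [[-> _]|-> _].
  rewrite /assigned big_nil => set0T.
  by move: J_gt0; rewrite -cardsT -set0T cards0.
(* The infimum is attained, so it can be replaced by the makespan of an actual partition. *)
have [[X partX ->] _] := opt_makespan_min c p m_gt0.
rewrite /makespan big_cons big_nil ge_max /completion /= add0r.
rewrite proc_time_le_partition //=.
(* The base [0] of the maximum in [makespan] must also lie below the bound. *)
by apply: mulr_ge0; [exact: ler0n | exact: bigmax_ge_id].
Qed.
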